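(* Let $\Gamma$ be a finite non-abelian group and set $\mathbb{G}=\widehat{\Gamma}$. Then there exists an orthogonal projection $P\in C(\mathbb{G})=\mathbb{C}[\Gamma]$ such that the quantum automorphism group of the quantum Cayley graph $(\mathbb{G},A_P)$, $A_P=P\star(\cdot)$, is equal to $\mathbb{G}$, i.e. the canonical surjection $\mathcal{O}(\operatorname{Qut}(\mathbb{G},A_P))\to\mathcal{O}(\mathbb{G})$ (intertwining the universal action with the comultiplication of $\mathbb{G}$) is an isomorphism of Hopf $*$-algebras.
   Context: $\widehat\Gamma$ is the finite quantum group with $C(\widehat\Gamma)=\mathbb{C}[\Gamma]$ (group algebra spanned by $\lambda_g$), $\Delta(\lambda_g)=\lambda_g\otimes\lambda_g$, antipode $S(\lambda_g)=\lambda_{g^{-1}}$, counit $\epsilon(\lambda_g)=1$. For a finite quantum group $\mathbb{G}$, $C(\mathbb{G})$ is regarded as a finite quantum set with $\psi$ the Haar functional normalized to be the tracial 1-form (the tracial positive functional with $mm^*=\mathrm{id}$ for the inner product $\langle x,y\rangle=\psi(x^*y)$). For $\omega\in C(\mathbb{G})^*$ put $L_\omega=(\omega\otimes\mathrm{id})\Delta$, $\psi_x(y)=\psi(xy)$, and define the convolution operator $x\star(\cdot)=L_{\psi_{S(x)}}$. For an orthogonal projection $P$, $A_P=P\star(\cdot)$ is a quantum adjacency matrix (the quantum Cayley graph of $P$). For a quantum graph $(\mathbb{X},A)$ (with $A\bullet A=A=\bar A$, where $A\bullet B=m(A\otimes B)m^*$, $\bar Af=(A(f^* ))^*$), $\operatorname{Qut}(\mathbb{X},A)$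 is the universal compact quantum group with a $\psi$-preserving action $\alpha$ on $C(\mathbb{X})$ satisfying $(A\otimes\mathrm{id})\alpha=\alpha A$; equivalently the universal $*$-algebra generated by entries of $U$ with $U$ unitary, $m(U\otimes U)=Um$, $U\eta=\eta$ ($\eta$ the unit), $UA=AU$. $\mathbb{G}$ acts on its quantum Cayley graphs via $\Delta$. *)

(* Defs.v *)
From HB Require Import structures.
From mathcomp Require Import all_boot all_algebra all_fingroup.
From mathcomp Require Import complex Rstruct.
Set Implicit Arguments. Unset Strict Implicit. Unset Printing Implicit Defensive.
Import GRing.Theory Num.Theory.
Local Open Scope ring_scope.

Definition CC := complex Rdefinitions.R.

Section GroupAlgebra.
Variable gT : finGroupType.

(* C(\hat Gamma) = C[Gamma]: an element a is sum_g (a g) lambda_g. *)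
Definition CG := {ffun gT -> CC}.

Definition lam (g : gT) : CG := [ffun h => (h == g)%:R].

Definition conv (a b : CG) : CG :=
  [ffun g => \sum_(h : gT) a h * b (h^-1 * g)%g].

Definition gstar (a : CG) : CG := [ffun g => (a (g^-1)%g)^*].

Definition antipode (a : CG) : CG := [ffun g => a (g^-1)%g].

(* comultiplication Delta(lambda_g) = lambda_g (x) lambda_g, with
   C[Gamma] (x) C[Gamma] = functions on gT * gT *)
Definition Delta (a : CG) : {ffun gT * gT -> CC} :=
  [ffun p => (p.1 == p.2)%:R * a p.1].

(* Haar functional normalised as the tracial 1-form (m m^* = id):
   psi(lambda_g) = |Gamma| * [g = 1]. *)
Definition psi (a : CG) : CC := #|gT|%:R * a 1%g.

Definition psi_at (x : CG) : CG -> CC := fun y => psi (conv x y).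

(* L_omega = (omega (x) id) Delta, for a linear functional omega *)
Definition Lop (omega : CG -> CC) (y : CG) : CG :=
  [ffun k => \sum_(g : gT) omega (lam g) * Delta y (g, k)].

Definition convop (x : CG) : CG -> CG := Lop (psi_at (antipode x)).

Definition Amat (P : CG) (g h : gT) : CC := convop P (lam h) g.

Definition is_orth_proj (P : CG) : Prop := conv P P = P /\ gstar P = P.

Definition is_star (B : algType CC) (st : B -> B) : Prop :=
  [/\ forall x y, st (x + y) = st x + st y,
      forall (c : CC) x, st (c *: x) = c^* *: st x,
      forall x y, st (x * y) = st y * st x
    & forall x, st (st x) = x].

(* Defining relations of O(Qut(G, A_P)) for a matrix U = (U g h) with entries
   in B, where the action is alpha(lambda_h) = sum_g lambda_g (x) U g h. *)
Definition QutRel (P : CG) (B : algType CC) (st : B -> B) (U : gT -> gT -> B) : Prop :=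
  [/\
      forall g h, \sum_(k : gT) st (U k g) * U k h = (g == h)%:R,
      forall g h, \sum_(k : gT) U g k * st (U h k) = (g == h)%:R,
      (* m (U (x) U) = U m *)
      forall g h k, U g (h * k)%g = \sum_(g1 : gT) U g1 h * U (g1^-1 * g)%g k,
      (* U eta = eta *)
      forall g, U g 1%g = (g == 1%g)%:R
    &
      forall g h, \sum_(k : gT) Amat P k h *: U g k = \sum_(k : gT) Amat P g k *: U k h].

Definition is_star_hom (B : algType CC) (st : B -> B) (phi : CG -> B) : Prop :=
  [/\ forall (c : CC) a b, phi (c *: a + b) = c *: phi a + phi b,
      forall a b, phi (conv a b) = phi a * phi b,
      phi (lam 1%g) = 1
    & forall a, phi (gstar a) = st (phi a)].

(* Qut(G, A_P) = G: (O(G), Delta) satisfies the universal property of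
   O(Qut(G, A_P)), i.e. every representation of the defining relations factors
   through the canonical map U g h |-> [g = h] lambda_g.  Equivalently, the
   canonical surjection O(Qut(G,A_P)) -> O(G) is an isomorphism. *)
Definition Qut_equals_G (P : CG) : Prop :=
  forall (B : algType CC) (st : B -> B) (U : gT -> gT -> B),
    is_star st -> QutRel P st U ->
    exists phi : CG -> B, is_star_hom st phi /\
      forall g h, U g h = phi ((g == h)%:R *: lam g).

End GroupAlgebra.

(* Main.v *)
(* A_P is diagonal in the basis lambda_g, with eigenvalues |Gamma| P(g), so the
   defining relations force U g h = 0 whenever P(g) <> P(h). The values of P on
   the centre are determined by the ranks of P in the blocks of C[Gamma], and in
   general no projection has pairwise distinct coefficients. It is enough that
   P(g) <> P(h) for g noncentral and h <> g: then U is diagonal on noncentral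
   elements, hence everywhere, since a central z is the product of the noncentral
   x and x^-1 z; a diagonal U is a unitary representation of Gamma.

   P(g) - P(h) is tau(D P) for the noncentral element
   D = lambda_(g^-1) - lambda_(h^-1), where tau(a) = a(1). Take for P a sum of
   minimal projections, one in each block of C[Gamma]. A noncentral D is
   nonscalar in some block, so that moving the minimal projection f of this block
   to a multiple of x f x^*, with x = 1 + n y, makes tau(D P) nonzero; as
   tau(D' x f x^* ) is quadratic in n, a suitable natural number n preserves the
   finitely many inequalities already obtained. *)
Require Import Defs.
From HB Require Import structures.
From mathcomp Require Import all_boot all_algebra all_fingroup all_field.
From mathcomp Require Import complex Rstruct.
From mathcomp Require Import ring.
From Stdlib Require Import Classical.
Set Implicit Arguments. Unset Strict Implicit. Unset Printing Implicit Defensive.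
Import GRing.Theory Num.Theory.
Local Open Scope ring_scope.

(** * Eigenvectors in invariant subspaces and nonroots of polynomials *)

Lemma exists_eigenvector (C : numClosedFieldType) (V : vectType C)
    (f : 'End(V)) (W : {vspace V}) :
  W != 0%VS -> (f @: W <= W)%VS ->
  exists c : C, exists2 w, w \in W & w != 0 /\ f w = c *: w.
Proof.
rewrite -dimv_eq0 -lt0n => W_gt0 fW.
pose b := vbasis W.
pose M : 'M[C]_(\dim W) := \matrix_(i, j) coord b j (f b`_i).
have fb (i : 'I_(\dim W)) : f b`_i = \sum_j M i j *: b`_j.
  rewrite [LHS](@coord_vbasis _ _ _ W); last first.
    by rewrite (subvP fW) ?memv_img ?vbasis_mem ?mem_nth ?size_tuple.
  by apply: eq_bigr => j _; rewrite mxE.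
(* [M] acts on rows, so a row eigenvector lists the coordinates of an eigenvector of [f] in [W]. *)
have [c /eigenvalueP[u uM u_neq0]] := eigenvalue_closed M W_gt0.
exists c, (\sum_i u 0 i *: b`_i).
  by apply: memv_suml => i _; rewrite memvZ ?vbasis_mem ?mem_nth ?size_tuple.
split.
  apply: contraNneq u_neq0 => u0; apply/eqP/rowP => i; rewrite mxE.
  by have /freeP/(_ (u 0) u0) -> := basis_free (vbasisP W).
rewrite linear_sum scaler_sumr.
under eq_bigr do rewrite linearZ /= fb scaler_sumr.
rewrite exchange_big; apply: eq_bigr => j _ /=.
have /rowP/(_ j) := uM; rewrite !mxE => uMj.
by rewrite scalerA -uMj scaler_suml; apply: eq_bigr => i _; rewrite scalerA.
Qed.

Lemma exists_nat_nonroot (C : numDomainType) (p : {poly C}) :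
  p != 0 -> exists n : nat, p.[n%:R] != 0.
Proof.
move=> p_neq0; apply: NNPP => nex.
have := @max_poly_roots _ p [seq n%:R | n <- iota 0 (size p)] p_neq0.
rewrite size_map size_iota ltnn map_inj_uniq ?iota_uniq; last first.
  by move=> m n /eqP; rewrite eqr_nat => /eqP.
suff -> : all (root p) [seq n%:R | n <- iota 0 (size p)] by move=> /(_ isT isT).
apply/allP => _ /mapP[n _ ->]; rewrite rootE; apply/negPn/negP => pn.
by apply: nex; exists n.
Qed.

(** * Finite-dimensional star algebras with a faithful trace *)

Section StarAlgebra.
Variables (C : numClosedFieldType) (A : falgType C).
Variables (star : A -> A) (tau : {scalar A}).
Hypothesis starD : forall x y, star (x + y) = star x + star y.
Hypothesis starZ : forall (c : C) x, star (c *: x) = c^* *: star x.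
Hypothesis starM : forall x y, star (x * y) = star y * star x.
Hypothesis starK : involutive star.
Hypothesis tauC : forall x y, tau (x * y) = tau (y * x).
Hypothesis tau_star : forall x, tau (star x) = (tau x)^*.
Hypothesis tau_def : forall x, tau (star x * x) = 0 -> x = 0.

Lemma star0 : star 0 = 0.
Proof. by apply: (addrI (star 0)); rewrite -starD !addr0. Qed.

Lemma star1 : star 1 = 1.
Proof. by rewrite -[star 1]mulr1 -{2}[1]starK -starM mulr1 starK. Qed.

Lemma star_sum (I : Type) (s : seq I) (F : I -> A) :
  star (\sum_(i <- s) F i) = \sum_(i <- s) star (F i).
Proof. by apply: (big_morph star starD star0). Qed.

Lemma tau_nondegenerate x : (forall y, tau (y * x) = 0) -> x = 0.
Proof. by move=> x0; apply: tau_def; apply: x0. Qed.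

(* e is the orthogonal projection of 1 onto V. *)
Lemma projection_of_right_ideal (V : {vspace A}) :
  (forall v a, v \in V -> v * a \in V) ->
  exists2 e, e \in V & star e = e /\ forall v, v \in V -> e * v = v.
Proof.
move=> Vr; pose b := vbasis V.
pose g (a : A) : 'rV[C]_(\dim V) := \row_i tau (star b`_i * a).
have g_lin : linear g.
  by move=> c x y; apply/rowP => i; rewrite !mxE mulrDr -scalerAr linearP.
pose gl := GRing.isLinear.Build _ _ _ _ g g_lin.
pose G : {linear _ -> _} := HB.pack g gl.
pose f := linfun G.
have fP a : (f a = 0) -> forall v, v \in V -> tau (star v * a) = 0.
  rewrite lfunE /= => ga0 v Vv.
  rewrite (coord_vbasis Vv) star_sum mulr_suml linear_sum big1 // => i _.
  rewrite starZ -scalerAl linearZ /=.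
  by have /rowP/(_ i) := ga0; rewrite !mxE => ->; rewrite mulr0.
(* Definiteness of [tau] makes [f] injective on [V], hence onto by dimension; so some [e] in [V] has
   the same pairings with [V] as 1. *)
have imf : (f @: V)%VS = fullv.
  apply/eqP; rewrite eqEdim subvf limg_dim_eq.
    by rewrite dimvf /dim /= mul1n.
  apply/eqP; rewrite -subv0; apply/subvP => v; rewrite memv_cap memv_ker memv0.
  by move=> /andP[Vv /eqP/fP/(_ v Vv)/tau_def->].
have /memv_imgP[e Ve fe] : f 1 \in (f @: V)%VS by rewrite imf memvf.
have Ve1 v : v \in V -> star v * (1 - e) = 0.
  move=> Vv; apply: tau_nondegenerate => y; rewrite mulrA -[y]starK -starM.
  by apply: fP; [rewrite linearB /= fe subrr|apply: Vr].
have stV v : v \in V -> star v * e = star v.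
  by move=> /Ve1/eqP; rewrite mulrBr mulr1 subr_eq0 => /eqP.
have ste : star e = e.
  by rewrite -[LHS](stV _ Ve) -{2}[e]starK -starM stV // starK.
exists e => //; split=> // v Vv.
by rewrite -[v]starK -{1}ste -starM stV.
Qed.

Definition minimal_projection f :=
  [/\ f != 0, f * f = f, star f = f & forall x, exists c, f * x * f = c *: f].

(* If e is not minimal, an eigenspace of the left multiplication by some e x e is a
   smaller nonzero right ideal. *)
Lemma exists_minimal_projection (V : {vspace A}) :
  (forall v a, v \in V -> v * a \in V) -> V != 0%VS ->
  exists2 f, f \in V & minimal_projection f.
Proof.
have [n] := ubnP (\dim V); elim: n V => // n IHn V leVn Vr V0.
have [e Ve [ste eV]] := projection_of_right_ideal Vr.
have e0 : e != 0.
  apply: contraNneq V0 => e0; rewrite -subv0; apply/subvP => v /eV.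
  by rewrite e0 mul0r => <-; rewrite mem0v.
have [min|] := classic (forall x, exists c, e * x * e = c *: e).
  by exists e => //; split=> //; apply: eV.
move=> /not_all_ex_not[x nx]; pose a := e * x * e.
have aV : (amull a @: V <= V)%VS.
  apply/subvP => _ /memv_imgP[v Vv ->].
  by rewrite lfunE /= /a -!mulrA Vr.
have [c [w Vw [w0]]] := exists_eigenvector V0 aV; rewrite lfunE /= => aw.
pose W := (V :&: lker (amull (a - c *: 1)))%VS.
have WP v : (v \in W) = (v \in V) && (a * v == c *: v).
  by rewrite memv_cap memv_ker lfunE /= mulrBl -scalerAl mul1r subr_eq0.
have [||| f] := IHn W.
- rewrite -ltnS (leq_trans _ leVn) // ltnS ltn_neqAle dimvS ?capvSl // andbT.
  (* If [W] were all of [V], it would contain [e], and [e * x * e = a * e] would be [c *: e],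
     against the choice of [x]. *)
  apply/negP => dimW.
  have WV : W = V by apply/eqP; rewrite eqEdim capvSl (eqP dimW) leqnn.
  apply: nx; exists c; move: (Ve); rewrite -{1}WV WP => /andP[_ /eqP <-].
  by rewrite /a -!mulrA (eV e Ve).
- move=> v b; rewrite !WP => /andP[Vv /eqP av]; rewrite Vr //= mulrA av.
  by rewrite scalerAl.
- by apply: contraNneq w0 => W0; rewrite -memv0 -W0 WP Vw aw eqxx.
by rewrite WP => /andP[Vf _] mf; exists f.
Qed.


(** * Families of minimal projections, one in each block *)

(** For minimal projections this says that distinct members lie in different blocks, without a
    Wedderburn decomposition. *)
Definition disjoint_projections (s : seq A) :=
  {in s &, forall f g, f != g -> forall x, f * x * g = 0}.

(** For [V] the whole algebra: every block meets the two-sided ideal generated by [s]. *)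
Definition separating (V : {vspace A}) (s : seq A) :=
  forall v, v \in V -> (forall f, f \in s -> forall x, f * x * v = 0) -> v = 0.

(** Induction on the two-sided ideal [V]: choose a minimal [f] in [V] and continue in the ideal [W]
    of those [v] in [V] with [f * x * v = 0] for all [x]. It is smaller, as [f] is not in it. *)
Lemma exists_separating_projections (V : {vspace A}) :
  (forall v a, v \in V -> v * a \in V) -> (forall v a, v \in V -> a * v \in V) ->
  exists s, [/\ uniq s, {in s, forall f, f \in V /\ minimal_projection f},
    disjoint_projections s & separating V s].
Proof.
have [n] := ubnP (\dim V); elim: n V => // n IHn V leVn Vr Vl.
have [V0|V0] := eqVneq V 0%VS.
  by exists [::]; split=> // v; rewrite V0 memv0 => /eqP.
have [f Vf mf] := exists_minimal_projection Vr V0.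
have [f0 ff sf _] := mf.
pose b := vbasis {:A}.
pose W := (V :&: \bigcap_(i < \dim {:A}) lker (amull (f * b`_i)%R))%VS.
have WP v : reflect (v \in V /\ forall x, f * x * v = 0) (v \in W).
  rewrite memv_cap; apply: (iffP andP) => -[Vv fv]; split=> //.
    move=> x; rewrite (coord_vbasis (memvf x)) mulr_sumr mulr_suml big1 // => i _.
    move: fv; rewrite memvE => /subv_bigcapP/(_ i isT).
    by rewrite -memvE memv_ker lfunE /= -scalerAr -scalerAl => /eqP ->; rewrite scaler0.
  rewrite memvE; apply/subv_bigcapP => i _.
  by rewrite -memvE memv_ker lfunE /= fv.
have fW : f \notin W.
  by apply/negP => /WP[_ /(_ 1)]; rewrite mulr1 ff; apply/eqP.
have [|||s [us sW ds ss]] := IHn W.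
- rewrite -ltnS (leq_trans _ leVn) // ltnS ltn_neqAle dimvS ?capvSl // andbT.
  apply: contraNneq fW => dimW.
  suff -> : W = V by [].
  by apply/eqP; rewrite eqEdim capvSl dimW leqnn.
- move=> v a /WP[Vv fv]; apply/WP; split; first exact: Vr.
  by move=> x; rewrite mulrA fv mul0r.
- move=> v a /WP[Vv fv]; apply/WP; split; first exact: Vl.
  by move=> x; rewrite mulrA -(mulrA f) fv.
exists (f :: s); split.
- by rewrite /= us andbT; apply: contra fW => /sW[].
- move=> g; rewrite inE => /predU1P[->//|/sW[/WP[Vg _] mg]]; by split.
- move=> g h; rewrite !inE => /predU1P[->|sg] /predU1P[->|sh]; rewrite ?eqxx //.
  + by move=> _ x; have [/WP[_ ->]] := sW _ sh.
  + move=> _ x; have [/WP[_ fg] [_ _ stg _]] := sW _ sg.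
    have -> : g * x * f = star (f * star x * g) by rewrite !starM starK sf stg mulrA.
    by rewrite fg star0.
  + exact: ds.
- move=> v Vv sv; apply: ss.
    by apply/WP; split=> // x; rewrite sv // mem_head.
  by move=> g sg x; rewrite sv // inE sg orbT.
Qed.

(** * Moving a minimal projection inside its block *)

Definition sandwich (x f : A) := x * f * star x.

Lemma star_sandwich x f : star f = f -> star (sandwich x f) = sandwich x f.
Proof. by move=> sf; rewrite /sandwich !starM starK sf mulrA. Qed.

Lemma tau_minimal_neq0 f : minimal_projection f -> tau f != 0.
Proof.
case=> f0 ff sf _; apply: contraNneq f0 => tf0; apply/eqP/tau_def.
by rewrite sf ff.
Qed.

Lemma tau_self_adjoint f : star f = f -> (tau f)^* = tau f.
Proof. by move=> sf; rewrite -tau_star sf. Qed.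

Lemma minimal_compress f x :
  minimal_projection f -> f * x * f = (tau (x * f) / tau f) *: f.
Proof.
move=> mf; have [_ ff _ /(_ x)[c fxf]] := mf.
have tf := tau_minimal_neq0 mf.
have: tau (f * x * f) = tau (x * f) by rewrite -mulrA tauC -mulrA ff.
by rewrite fxf linearZ /= => <-; rewrite mulfK.
Qed.

(** As [f * (star x * x) * f = (c / tau f) *: f], the square of [sandwich x f] is [c / tau f] times
    itself. The normalising factor is real, being a quotient of traces of self-adjoint elements. *)
Lemma minimal_sandwich f x (c := tau (sandwich x f)) :
  minimal_projection f -> c != 0 ->
  minimal_projection ((tau f / c) *: sandwich x f).
Proof.
move=> mf c0; have [f0 ff sf fm] := mf.
have tf := tau_minimal_neq0 mf.
have tfc0 : tau f / c != 0 by rewrite mulf_neq0 // invr_eq0.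
have mid z : sandwich x f * z * sandwich x f = x * (f * (star x * z * x) * f) * star x.
  by rewrite /sandwich !mulrA.
split.
- rewrite scaler_eq0 negb_or tfc0; apply: contraNneq c0 => sx0.
  by rewrite /c sx0 linear0.
- rewrite -scalerAl -scalerAr; have := mid 1; rewrite !mulr1 => ->.
  rewrite minimal_compress //.
  have -> : tau (star x * x * f) = c by rewrite /c /sandwich -mulrA tauC.
  rewrite -scalerAr -scalerAl -/(sandwich x f) !scalerA.
  by congr (_ *: _); field; rewrite c0.
- rewrite starZ star_sandwich // rmorphM fmorphV.
  by rewrite /= !tau_self_adjoint // star_sandwich.
- move=> z; have [d fd] := fm (star x * z * x); exists (tau f / c * d).
  rewrite -!scalerAl -scalerAr mid fd -scalerAr -scalerAl -/(sandwich x f).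
  by rewrite !scalerA mulrAC.
Qed.

(* Polarization. *)
Lemma sandwich_vanish_left f B :
  (forall y, tau (B * sandwich y f) = 0) -> forall x, f * x * B = 0.
Proof.
move=> B0; pose b y z := tau (B * (y * f * star z)).
have b0 y z : b y z = 0.
  have bc c : c^* * b y z + c * b z y = 0.
    have := B0 (y + c *: z); rewrite /sandwich starD starZ.
    rewrite !mulrDl !mulrDr -!scalerAl -!scalerAr !linearD /= !linearZ /=.
    rewrite (B0 y) (B0 z) !mulr0 addr0 add0r => /eqP.
    by move/eqP.
  have := bc 1; have := bc 'i; rewrite conjC1 conjCi !mul1r mulNr => /eqP.
  rewrite addrC subr_eq0 => /eqP/(mulfI (neq0Ci C)) ->.
  by move/eqP; rewrite -mulr2n mulrn_eq0 => /eqP.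
move=> x; apply: tau_nondegenerate => y; rewrite !mulrA tauC -[x]starK !mulrA.
by have := b0 y (star x); rewrite /b !mulrA.
Qed.

(** Otherwise, for each [f] in [s], polarization gives a [k] with [f * z * D = - k *: (f * z)] for
    all [z]. Then every [f * x] kills the commutator of [D] and [y], which is 0 by separation. The
    shift by [k] will absorb the contribution of the other projections. *)
Lemma exists_nonscalar_block s D :
  separating fullv s -> (exists y, D * y != y * D) ->
  exists2 f, f \in s & forall k : C, exists y, tau ((k *: 1 + D) * sandwich y f) != 0.
Proof.
move=> ss [y Dy]; apply: NNPP => nex; case/negP: Dy; rewrite -subr_eq0; apply/eqP.
apply: ss (memvf _) _ => f sf x.
have [k kD] : exists k : C, forall y, tau ((k *: 1 + D) * sandwich y f) = 0.
  apply: NNPP => nk; apply: nex; exists f => // k; apply: NNPP => ny.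
  by apply: nk; exists k => z; apply/eqP/negPn/negP => nz; apply: ny; exists z.
have fD z : f * z * D = - k *: (f * z).
  have /eqP := sandwich_vanish_left kD z.
  by rewrite mulrDr -scalerAr mulr1 addrC addr_eq0 scaleNr => /eqP.
by rewrite mulrBr !mulrA fD -scalerAl -(mulrA f x) fD mulrA subrr.
Qed.

(** Since [n] is its own conjugate, the trace is a polynomial [p B] in [n], with constant term
    [tau (B * f)] and quadratic coefficient [tau (B * sandwich y f)]. A nonroot of the product of
    all [p B] works. *)
Lemma exists_good_line f y (Bs : seq A) :
  {in Bs, forall B, tau (B * f) != 0 \/ tau (B * sandwich y f) != 0} ->
  exists n : nat, {in Bs, forall B, tau (B * sandwich (1 + n%:R *: y) f) != 0}.
Proof.
move=> nzB; pose p B : {poly C} :=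
  (tau (B * sandwich y f))%:P * 'X^2 +
  (tau (B * (y * f + f * star y)))%:P * 'X + (tau (B * f))%:P.
have pE B (n : nat) : (p B).[n%:R] = tau (B * sandwich (1 + n%:R *: y) f).
  rewrite /p !hornerD !hornerCM hornerXn hornerX hornerC /sandwich starD star1 starZ conjC_nat.
  rewrite !mulrDl !mulrDr !mul1r !mulr1 -!scalerAl -!scalerAr !linearD /= !linearZ /=.
  by ring.
have p0 : \prod_(B <- Bs) p B != 0.
  rewrite prodf_seq_neq0; apply/allP => B /nzB nz /=.
  apply/eqP => pB0; have coefp0 i : (p B)`_i = 0 by rewrite pB0 coef0.
  move: (coefp0 0%N) (coefp0 2%N).
  rewrite /p !coefD !coefCM !coefXn !coefX !coefC /= !mulr0 !mulr1 !addr0 !add0r.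
  by case: nz => /eqP.
have [n] := exists_nat_nonroot p0; rewrite horner_prod prodf_seq_neq0 => /allP pn.
by exists n => B /pn; rewrite /= pE.
Qed.

Definition separating_family s :=
  [/\ uniq s, {in s, forall f, minimal_projection f},
    disjoint_projections s & separating fullv s].

Lemma sandwich_family s f x (c := tau (sandwich x f)) :
  separating_family s -> f \in s -> c != 0 ->
  separating_family ((tau f / c) *: sandwich x f :: rem f s).
Proof.
case=> us ms ds ss fs c0; have mf := ms _ fs.
have tfc0 : tau f / c != 0 by rewrite mulf_neq0 ?invr_eq0 // tau_minimal_neq0.
have mf' := minimal_sandwich mf c0; set f' := _ *: _ in mf' *.
have dl g : g \in rem f s -> forall z, f' * z * g = 0.
  rewrite mem_rem_uniq // inE => /andP[gf gs] z.
  rewrite -!scalerAl /sandwich -!mulrA (mulrA _ z) (mulrA f) ds ?mulr0 ?scaler0 //.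
  by rewrite eq_sym.
have dr g : g \in rem f s -> forall z, g * z * f' = 0.
  rewrite mem_rem_uniq // inE => /andP[gf gs] z.
  by rewrite -!scalerAr /sandwich !mulrA -(mulrA g) (ds g f) ?mul0r ?scaler0.
split.
- rewrite /= rem_uniq // andbT; apply/negP => /dl/(_ 1).
  by case: mf' => f'0 f'f' _ _; rewrite mulr1 f'f'; apply/eqP.
- by move=> g; rewrite inE => /predU1P[->//|/mem_rem]; apply: ms.
- move=> g h; rewrite !inE => /predU1P[->|sg] /predU1P[->|sh]; rewrite ?eqxx //.
  + by move=> _; apply: dl.
  + by move=> _; apply: dr.
  + by apply: ds; apply: mem_rem; eassumption.
- move=> v _ sv; apply: ss (memvf _) _ => g gs z.
  have [->|gf] := eqVneq g f; last by rewrite sv // inE mem_rem_uniq // inE gf gs orbT.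
  have fv w : sandwich x f * w * v = 0.
    apply/eqP; have /eqP := sv f' (mem_head _ _) w.
    by rewrite -!scalerAl scaler_eq0 (negPf tfc0).
  have fxxf : f * (star x * x) * f = (c / tau f) *: f.
    by rewrite minimal_compress // -mulrA tauC.
  have ctf0 : c / tau f != 0 by rewrite mulf_neq0 ?invr_eq0 // tau_minimal_neq0.
  have fxv w : f * star x * w * v = 0.
    apply/eqP; have : f * star x * (sandwich x f * w * v) == 0 by rewrite fv mulr0.
    have -> : f * star x * (sandwich x f * w * v) =
        f * (star x * x) * f * star x * w * v by rewrite /sandwich !mulrA.
    by rewrite fxxf -!scalerAl scaler_eq0 (negPf ctf0).
  apply/eqP; have := fxv (x * f * z).
  (* Compressing [star x * x] by [f] once more recovers [f * z * v = 0] up to a nonzero scalar. *)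
  have -> : f * star x * (x * f * z) = f * (star x * x) * f * z by rewrite !mulrA.
  by rewrite fxxf -!scalerAl => /eqP; rewrite scaler_eq0 (negPf ctf0).
Qed.

Lemma exists_projection_avoiding (Ds : seq A) :
  {in Ds, forall D, exists y, D * y != y * D} ->
  exists P, [/\ P * P = P, star P = P & {in Ds, forall D, tau (D * P) != 0}].
Proof.
move=> ncD.
suff [s [us ms ds _] nz] : exists2 s, separating_family s &
    {in Ds, forall D, tau (D * \sum_(f <- s) f) != 0}.
  exists (\sum_(f <- s) f); split=> //; last first.
    by rewrite star_sum; apply: eq_big_seq => f /ms[].
  rewrite mulr_suml; apply: eq_big_seq => f fs.
  rewrite mulr_sumr (bigD1_seq f) //= big_seq_cond big1 ?addr0; first by case: (ms _ fs).
  by move=> g /andP[gs gf]; rewrite -[f]mulr1 ds // eq_sym.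
elim: Ds ncD => [|D Ds IHDs] ncD.
  have [|| s [us ms ds ss]] := @exists_separating_projections fullv.
  - by move=> *; rewrite memvf.
  - by move=> *; rewrite memvf.
  by exists s => //; split=> // f /ms[].
have [|s fam nz] := IHDs; first by move=> E DsE; apply: ncD; rewrite inE DsE orbT.
have [us ms ds ss] := fam.
have [f fs nsf] := exists_nonscalar_block ss (ncD _ (mem_head _ _)).
have mf := ms _ fs; have tf := tau_minimal_neq0 mf.
pose P := \sum_(g <- rem f s) g.
(* With f' the normalised sandwich, which has the trace of [f], [tau (E * (f' + P))] is a nonzero
   multiple of [tau ((K E *: 1 + E) * sandwich x f)]. The scaling of f' thus drops out. *)
pose K E := tau (E * P) / tau f.
have [y Dy] := nsf (K D).
(* The entry 1 keeps the trace of the sandwich nonzero. It and the old [E] are nonzero at [n = 0];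
   the new [D] has nonzero quadratic coefficient. *)
have [|n nzn] := @exists_good_line f y [:: 1, K D *: 1 + D & [seq K E *: 1 + E | E <- Ds]].
  move=> B; rewrite !inE => /or3P[/eqP->|/eqP->|/mapP[E DsE ->]].
  - by left; rewrite mul1r.
  - by right.
  - left; rewrite mulrDl -scalerAl mul1r linearD linearZ /= divfK //.
    by have := nz _ DsE; rewrite (big_rem f) //= mulrDr linearD addrC.
set x := 1 + n%:R *: y in nzn.
have c0 : tau (sandwich x f) != 0 by have := nzn _ (mem_head _ _); rewrite mul1r.
exists ((tau f / tau (sandwich x f)) *: sandwich x f :: rem f s).
  exact: sandwich_family.
move=> E DsE; rewrite big_cons -/P mulrDr -scalerAr linearD linearZ /=.
have : tau ((K E *: 1 + E) * sandwich x f) != 0.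
  apply: nzn; move: DsE; rewrite !inE => /predU1P[->|DsE]; first by rewrite eqxx orbT.
  by apply/or3P/Or33/mapP; exists E.
apply: contraNneq; rewrite mulrDl -scalerAl mul1r linearD linearZ /= => E0.
move: E0; rewrite /K addrC => /eqP; rewrite addr_eq0 => /eqP ->.
by apply/eqP; field; rewrite c0 tf.
Qed.

End StarAlgebra.

(* [CG gT] already carries the pointwise product, so convolution is put on a copy
   of it. *)
Definition galg (gT : finGroupType) := {ffun gT -> CC^o}.

(** * The group algebra with convolution, star and the trace [coef1] *)

Section GroupAlgebraRing.
Variable gT : finGroupType.
Implicit Types (a b c : galg gT) (g h k : gT).

HB.instance Definition _ := Vector.on (galg gT).

Lemma convA : associative (@conv gT : galg gT -> galg gT -> galg gT).
Proof.
move=> a b c; apply/ffunP => g; rewrite !ffunE.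
under eq_bigr do rewrite ffunE mulr_sumr.
under [RHS]eq_bigr do rewrite ffunE mulr_suml.
rewrite [RHS]exchange_big; apply: eq_bigr => h _ /=.
rewrite [RHS](reindex_inj (mulgI h)); apply: eq_bigr => k _ /=.
by rewrite mulrA mulKg invMg mulgA.
Qed.

Lemma conv_lam g a h : conv (lam g) a h = a (g^-1 * h)%g.
Proof.
rewrite ffunE (bigD1 g) //= big1 => [|k /negPf kg]; last first.
  by rewrite ffunE kg mul0r.
by rewrite ffunE eqxx mul1r addr0.
Qed.

Lemma conv_lamr g a h : conv a (lam g) h = a (h * g^-1)%g.
Proof.
rewrite ffunE (bigD1 (h * g^-1)%g) //= big1 => [|k kg].
  by rewrite ffunE invMg invgK mulgKV eqxx mulr1 addr0.
rewrite ffunE; case: eqP => [kh|_]; last by rewrite mulr0.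
by case/eqP: kg; rewrite -kh invMg invgK mulKVg.
Qed.

Lemma conv1l : left_id (lam 1%g : galg gT) (@conv gT).
Proof. by move=> a; apply/ffunP => g; rewrite conv_lam invg1 mul1g. Qed.

Lemma conv1r : right_id (lam 1%g : galg gT) (@conv gT).
Proof. by move=> a; apply/ffunP => g; rewrite conv_lamr invg1 mulg1. Qed.

Lemma convDl : left_distributive (@conv gT : galg gT -> galg gT -> galg gT) +%R.
Proof.
move=> a b c; apply/ffunP => g; rewrite !ffunE -big_split.
by apply: eq_bigr => h _; rewrite ffunE mulrDl.
Qed.

Lemma convDr : right_distributive (@conv gT : galg gT -> galg gT -> galg gT) +%R.
Proof.
move=> a b c; apply/ffunP => g; rewrite !ffunE -big_split.
by apply: eq_bigr => h _; rewrite ffunE mulrDr.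
Qed.

Lemma lam1_neq0 : (lam 1%g : galg gT) != 0.
Proof.
by apply/eqP => /ffunP/(_ 1%g)/eqP; rewrite !ffunE eqxx oner_eq0.
Qed.

HB.instance Definition _ := GRing.Zmodule_isNzRing.Build (galg gT)
  convA conv1l conv1r convDl convDr lam1_neq0.

Lemma convZl (k : CC) a b : k *: (a * b) = (k *: a) * b.
Proof.
apply/ffunP => g; rewrite !ffunE scaler_sumr.
by apply: eq_bigr => h _; rewrite ffunE scalerAl.
Qed.

Lemma convZr (k : CC) a b : k *: (a * b) = a * (k *: b).
Proof.
apply/ffunP => g; rewrite !ffunE scaler_sumr.
by apply: eq_bigr => h _; rewrite ffunE scalerAr.
Qed.

HB.instance Definition _ := GRing.Lmodule_isLalgebra.Build CC (galg gT) convZl.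
HB.instance Definition _ := GRing.Lalgebra_isAlgebra.Build CC (galg gT) convZr.
HB.instance Definition _ := Algebra_isFalgebra.Build CC (galg gT).

Definition coef1 (a : galg gT) : CC := a 1%g.

Lemma coef1_is_linear : linear_for *%R coef1.
Proof. by move=> k a b; rewrite /coef1 !ffunE. Qed.

HB.instance Definition _ :=
  GRing.isLinear.Build CC (galg gT) CC *%R coef1 coef1_is_linear.

Lemma coef1M a b : coef1 (a * b) = \sum_g a g * b (g^-1)%g.
Proof. by rewrite /coef1 ffunE; apply: eq_bigr => g _; rewrite mulg1. Qed.

Lemma coef1C a b : coef1 (a * b) = coef1 (b * a).
Proof.
rewrite !coef1M (reindex_inj invg_inj); apply: eq_bigr => g _ /=.
by rewrite invgK mulrC.
Qed.

Definition galg_star : galg gT -> galg gT := @gstar gT.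

Lemma galg_starD a b : galg_star (a + b) = galg_star a + galg_star b.
Proof. by apply/ffunP => g; rewrite !ffunE rmorphD. Qed.

Lemma galg_starZ (k : CC) a : galg_star (k *: a) = k^* *: galg_star a.
Proof. by apply/ffunP => g; rewrite !ffunE rmorphM. Qed.

Lemma galg_starM a b : galg_star (a * b) = galg_star b * galg_star a.
Proof.
apply/ffunP => g; rewrite !ffunE rmorph_sum (reindex_inj (mulgI g^-1%g)).
apply: eq_bigr => h _; rewrite !ffunE !invMg !invgK mulgK rmorphM.
exact: mulrC.
Qed.

Lemma galg_starK : involutive galg_star.
Proof. by move=> a; apply/ffunP => g; rewrite !ffunE invgK conjCK. Qed.

Lemma coef1_star a : coef1 (galg_star a) = (coef1 a)^*.
Proof. by rewrite /coef1 ffunE invg1. Qed.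

Lemma coef1_definite a : coef1 (galg_star a * a) = 0 -> a = 0.
Proof.
rewrite coef1C coef1M => /eqP.
under eq_bigr do rewrite ffunE invgK -normCK.
rewrite psumr_eq0 => [/allP a0|g _]; last exact: exprn_ge0.
apply/ffunP => g; rewrite ffunE; apply/eqP.
by have /implyP/(_ isT) := a0 g (mem_index_enum _); rewrite expf_eq0 normr_eq0.
Qed.

Definition glam g : galg gT := lam g.

Lemma coef1_lam g a : coef1 (glam g * a) = a (g^-1)%g.
Proof. exact: etrans (conv_lam g a 1%g) (congr1 a (mulg1 _)). Qed.

(** At [g * k] the left side has coefficient 1 and the right side 0 or -1, the latter when [k]
    conjugates [g] to [h]. *)
Lemma lamB_noncentral g h k : h != g -> (k * g)%g != (g * k)%g ->
  (glam g - glam h) * glam k != glam k * (glam g - glam h).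
Proof.
move=> hg kg; apply/eqP => /ffunP/(_ (g * k)%g)/eqP.
rewrite mulrBl mulrBr [_ (g * k)%g]ffunE [X in _ + X]ffunE [X in _ == X]ffunE.
rewrite [X in _ == _ + X]ffunE -![_ * _]/(conv _ _) !conv_lam !ffunE mulKg eqxx.
have -> : (h^-1 * (g * k) == k)%g = false.
  by rewrite mulgA -{2}[k]mul1g (inj_eq (mulIg k)) -eq_mulVg1; apply/negbTE.
have -> : (k^-1 * (g * k) == g)%g = false.
  by rewrite -(inj_eq (mulgI k)) mulKVg eq_sym; apply/negbTE.
by rewrite subr0 sub0r -addr_eq0 -natrD pnatr_eq0.
Qed.

End GroupAlgebraRing.

(** * Quantum automorphisms of the quantum Cayley graph *)

Section CayleyGraph.
Variable gT : finGroupType.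
Implicit Types (P : CG gT) (g h k : gT).

Lemma Amat_diag P g h : Amat P g h = (g == h)%:R * (#|gT|%:R * P g).
Proof.
rewrite /Amat /convop /Lop ffunE (bigD1 g) //= big1 => [|k /negPf kg]; last first.
  by rewrite ffunE kg mul0r mulr0.
rewrite addr0 ffunE eqxx mul1r ffunE /psi_at /psi mulrC.
by rewrite (conv_lamr g (antipode P)) ffunE mul1g invgK.
Qed.

Lemma QutRel_off_diag P (B : algType CC) (st : B -> B) (U : gT -> gT -> B) g h :
  QutRel P st U -> P g != P h -> U g h = 0.
Proof.
case=> _ _ _ _ /(_ g h) UA Pgh; apply/eqP; move/eqP: UA.
rewrite (bigD1 h) //= big1 => [|k /negPf kh]; last by rewrite Amat_diag kh mul0r scale0r.
rewrite (bigD1 g) //= big1 => [|k kg]; last first.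
  by rewrite Amat_diag eq_sym (negPf kg) mul0r scale0r.
rewrite !addr0 !Amat_diag !eqxx !mul1r -subr_eq0 -scalerBl -mulrBr scaler_eq0.
rewrite mulf_eq0 subr_eq0 [P h == _]eq_sym (negPf Pgh) pnatr_eq0 orbF.
by rewrite -cardsT (negPf (lt0n_neq0 (cardG_gt0 [set: gT]%G))).
Qed.

Lemma Qut_equals_G_of_diag P :
  (forall (B : algType CC) (st : B -> B) (U : gT -> gT -> B),
     QutRel P st U -> forall g h, g != h -> U g h = 0) ->
  Qut_equals_G P.
Proof.
move=> diagU B st U [stD stZ stM stK] QU; have diag := diagU B st U QU.
have [U1 _ Um Ue _] := QU.
pose u g := U g g.
have u1 : u 1%g = 1 by rewrite /u Ue eqxx.
have uM g h : u (g * h)%g = u g * u h.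
  rewrite /u Um (bigD1 g) //= mulKg big1 ?addr0 // => k kg.
  by rewrite diag // mul0r.
have uV g : st (u g) = u (g^-1)%g.
  have stu : st (u g) * u g = 1.
    have := U1 g g; rewrite eqxx (bigD1 g) //= big1 ?addr0 // => k kg.
    by rewrite (diag k g kg) mulr0.
  by rewrite -[LHS]mulr1 -u1 -(mulgV g) uM mulrA stu mul1r.
exists (fun a => \sum_g a g *: u g); split; last first.
  move=> g h; rewrite (bigD1 g) //= big1 => [|k /negPf kg]; last first.
    by rewrite !ffunE kg scaler0 scale0r.
  rewrite !ffunE eqxx addr0; have [->|gh] := eqVneq g h.
    by rewrite scale1r scale1r.
  by rewrite !scale0r diag.
split.
- move=> c a b; rewrite scaler_sumr -big_split; apply: eq_bigr => g _ /=.
  by rewrite !ffunE scalerDl scalerA.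
- move=> a b; rewrite mulr_suml.
  under eq_bigr do rewrite ffunE scaler_suml.
  rewrite exchange_big; apply: eq_bigr => h _ /=.
  rewrite mulr_sumr (reindex_inj (mulgI h)); apply: eq_bigr => k _ /=.
  by rewrite mulKg uM -scalerAl -scalerAr scalerA.
- rewrite (bigD1 1%g) //= big1 => [|k /negPf k1]; last by rewrite ffunE k1 scale0r.
  by rewrite ffunE eqxx scale1r addr0 u1.
- move=> a.
  have st0 : st 0 = 0 by apply: (addrI (st 0)); rewrite -stD !addr0.
  rewrite (big_morph st stD st0) (reindex_inj invg_inj); apply: eq_bigr => g _ /=.
  by rewrite ffunE invgK stZ uV.
Qed.

Lemma Qut_equals_G_of_coefs P :
  ~~ abelian [set: gT] ->
  (forall g h, g \notin 'C([set: gT])%g -> h != g -> P g != P h) ->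
  Qut_equals_G P.
Proof.
move=> nab Pinj; apply: Qut_equals_G_of_diag => B st U QU.
have offd g h : (g \notin 'C([set: gT])%g) || (h \notin 'C([set: gT])%g) ->
    g != h -> U g h = 0.
  move=> /orP[gZ|hZ] gh; apply: (QutRel_off_diag QU).
    by apply: Pinj; rewrite // eq_sym.
  by rewrite eq_sym; apply: Pinj.
have [x xZ] : exists x, x \notin 'C([set: gT])%g.
  apply/existsP; rewrite -negb_forall; apply: contra nab => /forallP allZ.
  by apply/subsetP => y _; apply: allZ.
move=> g z gz; have [zZ|] := boolP (z \in 'C([set: gT])%g); last first.
  by move=> zZ; apply: offd gz; rewrite zZ orbT.
have xzZ : (x^-1 * z)%g \notin 'C([set: gT])%g.
  by rewrite groupMr // groupV.
have [_ _ Um _ _] := QU.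
(* In the expansion of [U g (x * (x^-1 * z))], the factor [U k x] vanishes for [k != x]; at [k = x]
   the other factor does, because [x^-1 * z] is noncentral and differs from [x^-1 * g]. *)
rewrite -[z](mulKVg x) Um big1 // => k _.
have [->|kx] := eqVneq k x; last by rewrite offd ?mul0r // xZ orbT.
by rewrite [U (_ * g)%g _]offd ?mulr0 ?xzZ ?orbT // (inj_eq (mulgI _)).
Qed.

End CayleyGraph.

Theorem theorem6p3 (gT : finGroupType) (nonab : ~~ abelian [set: gT]) :
  exists P : CG gT, is_orth_proj P /\ Qut_equals_G P.
Proof.
(* Inverses appear because [coef1 (glam g^-1 * P)] is [P g]. *)
pose Ds : seq (galg gT) := [seq glam (p.1)^-1%g - glam (p.2)^-1%g
  | p in [pred p : gT * gT | (p.1 \notin 'C([set: gT])%g) && (p.2 != p.1)]].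
have [|P [PP sP nzP]] := exists_projection_avoiding (@galg_starD gT) (@galg_starZ gT)
    (@galg_starM gT) (@galg_starK gT) (@coef1C gT) (@coef1_star gT)
    (@coef1_definite gT) (Ds := Ds).
  move=> _ /imageP[[g h] /andP[/= gZ hg] ->].
  have /existsP[k kg] : [exists k, (k * g^-1 != g^-1 * k)%g].
    apply: contraR gZ; rewrite negb_exists => /forallP gC.
    rewrite -groupV; apply/centP => k _; apply/eqP.
    by rewrite eq_sym; apply/negPn/gC.
  by exists (glam k); apply: lamB_noncentral; rewrite ?(inj_eq invg_inj).
exists P; split; first by split.
apply: Qut_equals_G_of_coefs => // g h gZ hg.
have /nzP : glam g^-1%g - glam h^-1%g \in Ds.
  by apply/imageP; exists (g, h) => //; rewrite inE /= gZ.
by rewrite mulrBl linearB /= !coef1_lam !invgK subr_eq0.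
Qed.
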